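(* Let $n\in\mathbb{N}$ and let $\zeta_n$ be a primitive $n$-th root of unity. For all $l,s\in\mathbb{Z}_{\geq 0}$, the sum $$W_n^2(l,s)=\sum_{\substack{d_0+d_1+\cdots+d_s=l\\ d_0,\ldots,d_s\geq 0}}z_n\left(\{2\}^{d_0},3,\{2\}^{d_1},3,\ldots,3,\{2\}^{d_s};\zeta_n\right)$$ (in which the entry $3$ occurs exactly $s$ times) satisfies $$W_n^2(l,s)=\frac{(-1)^l}{n^2(s+1)}\binom{s+l}{l}\left[\binom{n+2s+l+1}{3s+2l+2}+(-1)^s\binom{n+s+l}{3s+2l+2}\right](1-\zeta_n)^{3s+2l}.$$
   Context: $\mathbb{N}$ is the set of positive integers. For $n\in\mathbb{N}$, a complex number $q$ with $q^m\neq 1$ for all $m\in\mathbb{N}$ with $m<n$, and a multi-index $(k_1,\ldots,k_d)\in\mathbb{N}^d$, the finite multiple harmonic $q$-series is $$z_n(k_1,\ldots,k_d;q)=\sum_{n>m_1>\cdots>m_d>0}\frac{q^{(k_1-1)m_1+\cdots+(k_d-1)m_d}}{[m_1]^{k_1}\cdots[m_d]^{k_d}},\qquad [m]=\frac{1-q^m}{1-q},$$ where $m_1,\dots,m_d$ are integers. An empty sum is $0$, and for the empty multi-index ($d=0$) one sets $z_n(\emptyset;q)=1$. The notation $\{a\}^{m}$ means $a$ repeated $m$ times. Binomial coefficients $\binom{a}{b}$ with integers $a\ge 0$ are $0$ if $b<0$ or $b>a$; $0^0=1$. *)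

(* Defs.v *)
From mathcomp Require Import all_boot all_order all_algebra.
From mathcomp Require Import reals complex.

Set Implicit Arguments.
Unset Strict Implicit.
Unset Printing Implicit Defensive.

Import GRing.Theory.
Local Open Scope ring_scope.

Definition qint (F : fieldType) (q : F) (m : nat) : F := (1 - q ^+ m) / (1 - q).

(* The finite multiple harmonic q-series z_n(k_1, ..., k_d; q), with
   ks = [:: k_1; ...; k_d], all k_i > 0. It is meaningful when q ^+ m != 1 for
   0 < m < n: then every [m_i] occurring below is a quotient of nonzero
   elements (for n <= 1 the sum is empty unless d = 0).
   The bound n > m_1 is carried by the type 'I_n. *)
Definition mhqs (F : fieldType) (n : nat) (ks : seq nat) (q : F) : F :=
  \sum_(m : (size ks).-tuple 'I_n
        | sorted gtn (map val m) && all (fun j : 'I_n => (0 < j)%N) m)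
    \prod_(i < size ks)
      (q ^+ ((nth 0%N ks i).-1 * tnth m i)
         / qint q (tnth m i) ^+ nth 0%N ks i).

(* interleave a b [:: d_0; ...; d_s] is {a}^{d_0}, b, {a}^{d_1}, b, ..., b,
   {a}^{d_s}, where b occurs s times. *)
Definition interleave (a b : nat) (d : seq nat) : seq nat :=
  nseq (head 0%N d) a ++ flatten [seq b :: nseq dj a | dj <- behead d].

(* W_n^2(l, s), as a function of q. The constraint sum d_j = l forces
   d_j <= l, so letting the d_j range over 'I_l.+1 loses nothing. *)
Definition W2 (F : fieldType) (n l s : nat) (q : F) : F :=
  \sum_(d : s.+1.-tuple 'I_l.+1 | (\sum_(j < s.+1) tnth d j)%N == l)
    mhqs n (interleave 2 3 (map val d)) q.

(* Main.v *)
Require Import Defs.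
From mathcomp Require Import all_boot all_order all_algebra.
From mathcomp Require Import reals complex.
From mathcomp Require Import ring zify.

Set Implicit Arguments.
Unset Strict Implicit.
Unset Printing Implicit Defensive.

Import GRing.Theory.
Local Open Scope ring_scope.

(* Summing z_n over all words with l letters 2 and s letters 3 gives the
   coefficient of x^l y^s in prod_(0 < m < n) (1 + a_m x + b_m y), where
   a_m = u (1 - zeta)^2 / (1 - u)^2, b_m = u^2 (1 - zeta)^3 / (1 - u)^3 and
   u = zeta^m. Up to the powers of 1 - zeta, the m-th factor is
   P(u) / (1 - u)^3 with P(u) = (1 - u)^3 + x u (1 - u) + y u^2. Write
   P(u) = (1 - alpha u)(1 - beta u)(1 - gamma u); then alpha beta gamma = 1,
   and since P(1) = y and prod_(0 < m < n) (1 - zeta^m) = n,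
     n^3 y prod_m P(u) / (1 - u)^3
       = (1 - alpha^n)(1 - beta^n)(1 - gamma^n)
       = sum alpha^(-n) - sum alpha^n.
   The y-derivative of a power sum of degree n is n times a complete homogeneous
   symmetric polynomial (up to sign), because d(- log P) = - dP / P; the
   coefficients of these polynomials in x and y are products of two binomial
   coefficients, by Pascal's rule. *)

(** * Sums over words in the letters 2 and 3 *)

Section WordSums.
Variable F : comNzRingType.

Lemma big_tuple_cons (I : finType) (d : nat) (P : pred (d.+1.-tuple I))
    (G : d.+1.-tuple I -> F) :
  \sum_(t | P t) G t =
  \sum_(i : I) \sum_(t : d.-tuple I | P [tuple of i :: t]) G [tuple of i :: t].
Proof.
rewrite pair_big_dep /=.
rewrite (reindex (fun p : I * d.-tuple I => [tuple of p.1 :: p.2])) //=.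
exists (fun t => (thead t, [tuple of behead t])) => [[i t] _|t _] /=.
  by congr pair; apply: val_inj.
by case/tupleP: t => i t; apply: val_inj.
Qed.

Variable w : nat -> nat -> F.

Fixpoint nested_sum (n : nat) (ks : seq nat) : F :=
  if ks is k :: ks' then \sum_(m < n) w m k * nested_sum m ks' else 1.

Lemma nested_sumS n k ks :
  nested_sum n.+1 (k :: ks) = nested_sum n (k :: ks) + w n k * nested_sum n ks.
Proof. by rewrite /= big_ord_recr. Qed.

(** The tail of a tuple is bounded by its head but still lives in ['I_N], so the bound [n] varies in
    the induction while [N] stays fixed. *)
Lemma tuple_sumE (N n : nat) (ks : seq nat) : (n <= N)%N ->
  \sum_(m : (size ks).-tuple 'I_N | path gtn n (map val m))
    \prod_(i < size ks) w (tnth m i) (nth 0%N ks i) = nested_sum n ks.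
Proof.
elim: ks n => [|k ks IH] n nN /=.
  rewrite (big_pred1 [tuple]) => [|t]; first by rewrite big_ord0.
  by rewrite [t]tuple0 /= eqxx.
rewrite big_tuple_cons /=.
rewrite (big_ord_widen N (fun m => w m k * nested_sum m ks) nN) [RHS]big_mkcond /=.
apply: eq_bigr => i _; case: ifP => i_n; last by rewrite big_pred0.
rewrite -IH ?mulr_sumr; last exact: ltnW.
apply: eq_big => [t|t _] //.
rewrite big_ord_recl /=; congr (_ * _).
by apply: eq_bigr => j _; rewrite tnthS.
Qed.

(** The recursion picks [d_0] and pushes the prefix into the argument of [f]; the last block is
    forced to take all remaining 2s. *)
Fixpoint word_sum (s l : nat) (f : seq nat -> F) : F :=
  if s is s'.+1 then
    \sum_(d < l.+1) word_sum s' (l - d) (fun v => f (nseq d 2 ++ 3 :: v))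
  else f (nseq l 2).

Lemma word_sumE (N s l : nat) (f : seq nat -> F) : (l < N)%N ->
  \sum_(d : s.+1.-tuple 'I_N | (\sum_(j < s.+1) tnth d j)%N == l)
    f (interleave 2 3 (map val d)) = word_sum s l f.
Proof.
elim: s l f => [|s IH] l f lN.
  rewrite (big_pred1 [tuple Ordinal lN]) => [|t] /=.
    by rewrite /interleave /= cats0.
  case/tupleP: t => i t; rewrite [t]tuple0 big_ord1.
  by rewrite -!val_eqE /= eqseq_cons andbT.
rewrite big_tuple_cons /=.
rewrite (big_ord_widen N (fun d => word_sum s (l - d)
   (fun v => f (nseq d 2 ++ 3 :: v))) lN) [RHS]big_mkcond /=.
apply: eq_bigr => i _; case: ifP => il; last first.
  rewrite big_pred0 // => t; rewrite big_ord_recl /=; apply/eqP.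
  rewrite tnth0; lia.
rewrite -IH; last by apply: leq_ltn_trans lN; apply: leq_subr.
apply: eq_big => [t|t _]; last by case/tupleP: t => j t.
rewrite /= big_ord_recl tnth0.
rewrite [X in (_ + X)%N](eq_bigr (fun j => tnth t j : nat)) => [|j _]; last by rewrite tnthS.
by apply/eqP/eqP; lia.
Qed.

Lemma eq_word_sum s l (f g : seq nat -> F) : f =1 g -> word_sum s l f = word_sum s l g.
Proof.
elim: s l f g => [|s IH] l f g fg /=; first exact: fg.
by apply: eq_bigr => d _; apply: IH => v; apply: fg.
Qed.

Lemma word_sum_linear s l (f g : seq nat -> F) c :
  word_sum s l (fun v => f v + c * g v) = word_sum s l f + c * word_sum s l g.
Proof.
elim: s l f g => [|s IH] l f g //=.
rewrite mulr_sumr -big_split /=.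
by apply: eq_bigr => d _; rewrite IH.
Qed.

Lemma word_sumS0 s f : word_sum s.+1 0 f = word_sum s 0 (fun v => f (3 :: v)).
Proof. by rewrite /= big_ord1. Qed.

(** The split is by the first letter: 3 when [d_0 = 0], otherwise 2. *)
Lemma word_sumSS s l f : word_sum s.+1 l.+1 f =
  word_sum s l.+1 (fun v => f (3 :: v)) + word_sum s.+1 l (fun v => f (2 :: v)).
Proof. by rewrite /= big_ord_recl subn0. Qed.

Lemma word_sum_nested0 s l :
  word_sum s l (nested_sum 0) = ((s == 0%N) && (l == 0%N))%:R.
Proof.
have z t k f : (forall v, f v = 0) -> word_sum t k f = 0.
  elim: t k f => [|t IH] k f f0 /=; first exact: f0.
  by rewrite big1 // => d _; apply: IH.
case: s l => [|s] [|l] //=; first by rewrite big_ord0.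
  by rewrite big1 // => d _; apply: z => v; case: (val d) => /= *; rewrite big_ord0.
by rewrite big1 // => d _; apply: z => v; case: (val d) => /= *; rewrite big_ord0.
Qed.

Variables (a b : nat -> F) (c : F).

(** The outer variable y marks the letters 3, the inner variable x the letters 2. *)
Definition word_gf (n : nat) : {poly {poly F}} :=
  \prod_(m < n) (1 + (a m *: 'X)%:P + (b m)%:P *: 'X).

Lemma coef_word_gf n s l :
    (forall m, w m 2 = c ^+ 2 * a m) -> (forall m, w m 3 = c ^+ 3 * b m) ->
  word_sum s l (nested_sum n) = c ^+ (3 * s + 2 * l) * (word_gf n)`_s`_l.
Proof.
move=> wa wb; elim: n s l => [|n IH] s l.
  rewrite word_sum_nested0 /word_gf big_ord0 coef1.
  case: s => [|s] /=; last by rewrite coef0 mulr0.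
  by rewrite coef1; case: l => [|l]; rewrite ?mulr0 ?expr0 ?mulr1.
have cf s' l' : (word_gf n.+1)`_s'`_l' = (word_gf n)`_s'`_l'
     + a n * (if l' is l''.+1 then (word_gf n)`_s'`_l'' else 0)
     + b n * (if s' is s''.+1 then (word_gf n)`_s''`_l' else 0).
  rewrite /word_gf big_ord_recr /= -/(word_gf n) !mulrDr mulr1 !coefD coefMC.
  rewrite -!scalerAr coefZ coefMX coefZ coefMX coefCM.
  by case: s' l' => [|s'] [|l'] /=; rewrite ?coef0 //.
rewrite cf; case: s l => [|s] [|l].
- by rewrite -[LHS]/1 !mulr0 !addr0 -IH.
- rewrite -[LHS]/(nested_sum n.+1 (2 :: nseq l 2)) nested_sumS wa.
  rewrite -[nested_sum n (nseq _ _)]/(word_sum 0 l (nested_sum n)) IH.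
  rewrite -[nested_sum _ _]/(word_sum 0 l.+1 (nested_sum n)) IH.
  have -> : (3 * 0 + 2 * l.+1 = (3 * 0 + 2 * l).+2)%N by lia.
  by rewrite !exprS; ring.
- rewrite word_sumS0 (eq_word_sum _ _ (g := fun v => nested_sum n (3 :: v)
     + w n 3 * nested_sum n v)); last by move=> v; rewrite nested_sumS.
  rewrite word_sum_linear -word_sumS0 !IH wb.
  have -> : (3 * s.+1 + 2 * 0 = (3 * s + 2 * 0).+3)%N by lia.
  by rewrite !exprS; ring.
rewrite word_sumSS (eq_word_sum _ _ (g := fun v => nested_sum n (3 :: v)
     + w n 3 * nested_sum n v)); last by move=> v; rewrite nested_sumS.
rewrite [X in _ + X](eq_word_sum _ _ (g := fun v => nested_sum n (2 :: v)
     + w n 2 * nested_sum n v)); last by move=> v; rewrite nested_sumS.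
rewrite !word_sum_linear addrACA -word_sumSS !IH wa wb.
have -> : (3 * s.+1 + 2 * l.+1 = (3 * s + 2 * l).+2.+3)%N by lia.
have -> : (3 * s.+1 + 2 * l = (3 * s + 2 * l).+3)%N by lia.
have -> : (3 * s + 2 * l.+1 = (3 * s + 2 * l).+2)%N by lia.
by rewrite !exprS; ring.
Qed.

End WordSums.

(** * Symmetric functions of three quantities with product 1 *)

(* hsym e1 e2 n is the complete homogeneous symmetric polynomial of degree n - 2
   (0 for n < 2) in three quantities whose elementary symmetric functions are
   e1, e2 and 1. *)
Fixpoint hsym (A : comNzRingType) (e1 e2 : A) (n : nat) : A :=
  match n with
  | n2.+1 => match n2 with
    | n1.+1 => match n1 with
      | n0.+1 => e1 * hsym e1 e2 n2 - e2 * hsym e1 e2 n1 + hsym e1 e2 n0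
      | 0 => 1
      end
    | 0 => 0
    end
  | 0 => 0
  end.

(* The n-th power sum p_n: with D = 1 - e1 t + e2 t^2 - t^3,
   sum_n p_n t^n = 3 - t D'(t) / D(t) = (3 - 2 e1 t + e2 t^2) / D(t). *)
Definition psum (A : comNzRingType) (e1 e2 : A) (n : nat) : A :=
  3%:R * hsym e1 e2 n.+2 - 2%:R * e1 * hsym e1 e2 n.+1 + e2 * hsym e1 e2 n.

Lemma hsymS3 (A : comNzRingType) (e1 e2 : A) n : hsym e1 e2 n.+3 =
  e1 * hsym e1 e2 n.+2 - e2 * hsym e1 e2 n.+1 + hsym e1 e2 n.
Proof. by []. Qed.

Lemma nat_ind3 (P : nat -> Prop) : P 0 -> P 1 -> P 2 ->
  (forall n, P n -> P n.+1 -> P n.+2 -> P n.+3) -> forall n, P n.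
Proof.
move=> P0 P1 P2 PS n; suff [] : [/\ P n, P n.+1 & P n.+2] by [].
by elim: n => [|n [? ? ?]]; split=> //; apply: PS.
Qed.

Lemma psumS3 (A : comNzRingType) (e1 e2 : A) n : psum e1 e2 n.+3 =
  e1 * psum e1 e2 n.+2 - e2 * psum e1 e2 n.+1 + psum e1 e2 n.
Proof. by rewrite /psum !hsymS3; ring. Qed.

Lemma rmorph_hsym (A B : comNzRingType) (f : {rmorphism A -> B}) e1 e2 n :
  f (hsym e1 e2 n) = hsym (f e1) (f e2) n.
Proof.
elim/nat_ind3: n => [|||n IH0 IH1 IH2]; rewrite ?rmorph0 ?rmorph1 //.
by rewrite !hsymS3 rmorphD rmorphB !rmorphM IH0 IH1 IH2.
Qed.

Lemma rmorph_psum (A B : comNzRingType) (f : {rmorphism A -> B}) e1 e2 n :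
  f (psum e1 e2 n) = psum (f e1) (f e2) n.
Proof. by rewrite /psum rmorphD rmorphB !rmorphM !rmorph_nat !rmorph_hsym. Qed.

(** Each of [x], [y], [z] satisfies t^3 = e1 t^2 - e2 t + 1, so both sides obey the same recurrence,
    with the same first three values. *)
Lemma psum_roots (A : comNzRingType) (x y z : A) n : x * y * z = 1 ->
  psum (x + y + z) (x * y + y * z + z * x) n = x ^+ n + y ^+ n + z ^+ n.
Proof.
move=> e3; elim/nat_ind3: n => [|||n IH0 IH1 IH2].
- by rewrite /psum /=; ring.
- by rewrite /psum /=; ring.
- by rewrite /psum /=; ring.
rewrite psumS3 IH0 IH1 IH2 -[X in _ + X]mul1r -e3 !exprS; ring.
Qed.

(* Coefficientwise derivative of - log D = sum_n p_n t^n / n with respect to a parameter on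
   which e1 and e2 depend. *)
Lemma deriv_psum (A : comNzRingType) (e1 e2 : {poly A}) n :
  (psum e1 e2 n)^`() =
  n%:R * (e1^`() * hsym e1 e2 n.+1 - e2^`() * hsym e1 e2 n).
Proof.
elim/nat_ind3: n => [|||n IH0 IH1 IH2].
- by rewrite /psum /= !derivE; ring.
- by rewrite /psum /= !derivE; ring.
- by rewrite /psum /= !derivE; ring.
rewrite psumS3 derivD derivB !derivM IH0 IH1 IH2 /psum !hsymS3 -!natr1; ring.
Qed.

(** * Coefficients of the homogeneous polynomials in x and y *)

Section Coefficients.
Variable A : comNzRingType.

(** Third difference of a binomial: (1 + t)^3 - 3 (1 + t)^2 + 3 (1 + t) - 1 = t^3, multiplied by (1
    + t)^N. *)
Lemma binS3 (N K : nat) :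
  'C(N.+3, K)%:R = 3%:R * 'C(N.+2, K)%:R - 3%:R * 'C(N.+1, K)%:R + 'C(N, K)%:R
    + (if K is k.+3 then 'C(N, k) else 0)%:R :> A.
Proof.
case: K => [|[|[|k]]]; rewrite ?bin0 ?bin1 ?binS ?bin0 ?bin1 ?natrD -?natr1; ring.
Qed.

Let X : {poly {poly A}} := ('X : {poly A})%:P.

Lemma coef_XM (p : {poly {poly A}}) s l :
  (X * p)`_s`_l = if l is l'.+1 then p`_s`_l' else 0.
Proof. by rewrite /X coefCM coefXM; case: l. Qed.

Lemma coef_YM (p : {poly {poly A}}) s l :
  ('X * p)`_s`_l = if s is s'.+1 then p`_s'`_l else 0.
Proof. by rewrite coefXM; case: s => //=; rewrite coef0. Qed.

Lemma coef_natM (p : {poly {poly A}}) k s l :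
  (k%:R * p)`_s`_l = k%:R * p`_s`_l.
Proof. by rewrite !mulr_natl !coefMn. Qed.

(** Here D = (1 - t)^3 + x t (1 - t) + y t^2, and expanding t^2 / D gives t^(2s+l+2) / (1 -
    t)^(3s+2l+3) at x^l y^s, up to sign and ['C(s + l, l)]. The induction checks this against the
    recurrence. *)
Lemma coef_hsym1 n s l : (hsym (3%:R - X) (3%:R - X + 'X) n)`_s`_l =
  (-1) ^+ (l + s) * 'C(s + l, l)%:R * 'C(n + s + l, 3 * s + 2 * l + 2)%:R.
Proof.
elim/nat_ind3: n s l => [|||n IH0 IH1 IH2] s l.
- by rewrite /= !coef0 (@bin_small _ (3 * _ + 2 * _ + 2)%N) ?mulr0 //; lia.
- by rewrite /= !coef0 (@bin_small _ (3 * _ + 2 * _ + 2)%N) ?mulr0 //; lia.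
- rewrite /= coef1; case: s => [|s]; last first.
    by rewrite coef0 (@bin_small _ (3 * _ + 2 * _ + 2)%N) ?mulr0 //; lia.
  rewrite coef1; case: l => [|l].
    by rewrite !bin0 expr0 !mul1r.
  by rewrite (@bin_small _ (3 * _ + 2 * _ + 2)%N) ?mulr0 //; lia.
pose d := hsymS3 (3%:R - X) (3%:R - X + 'X) n; rewrite {}d.
set a := hsym _ _ n.+2 in IH2 *; set b := hsym _ _ n.+1 in IH1 *.
set c := hsym _ _ n in IH0 *.
have -> : (3%:R - X) * a - (3%:R - X + 'X) * b + c
        = a *+ 3 - X * a - b *+ 3 + X * b - 'X * b + c by ring.
rewrite !(coefD, coefN, coefMn) !coef_XM !coef_YM.
case: s l => [|s] [|l]; rewrite !IH0 !IH1 !IH2 {a b c IH0 IH1 IH2}.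
- by rewrite !(muln0, addn0, add0n, bin0) (binS3 n) /=; ring.
- rewrite !(muln0, addn0, add0n, binn).
  have -> : (2 * l.+1 + 2 = (2 * l).+1.+3)%N by lia.
  have -> : (2 * l + 2 = (2 * l).+2)%N by lia.
  rewrite !(addSn, addnS) (binS3 (n + l).+1) /= (binS (n + l).+1 (2 * l).+1).
  by rewrite natrD !exprS; ring.
- rewrite !(muln0, addn0, add0n, bin0).
  have -> : (3 * s.+1 + 2 = (3 * s).+2.+3)%N by lia.
  have -> : (3 * s + 2 = (3 * s).+2)%N by lia.
  by rewrite !(addSn, addnS) (binS3 (n + s).+1) /= !exprS; ring.
have -> : (3 * s.+1 + 2 * l.+1 + 2 = (3 * s + 2 * l).+4.+3)%N by lia.
have -> : (3 * s.+1 + 2 * l + 2 = (3 * s + 2 * l).+4.+1)%N by lia.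
have -> : (3 * s + 2 * l.+1 + 2 = (3 * s + 2 * l).+4)%N by lia.
(* Pascal's rule in the upper index merges the two x-terms into the binomial left by the third
   difference and by the y-term; the prefactors then agree by Pascal's rule for
   ['C((s + l).+2, l.+1)]. *)
rewrite !(addSn, addnS) (binS3 (n + s + l).+2) /= (binS _ (3 * s + 2 * l).+4) (binS (s + l).+1 l).
by rewrite !natrD !exprS; ring.
Qed.

(** With [e1] and [e2] exchanged, D = (1 - t)^3 + x t (1 - t) - y t, so y brings no sign and only
    one power of t. *)
Lemma coef_hsym2 n s l : (hsym (3%:R - X + 'X) (3%:R - X) n)`_s`_l =
  (-1) ^+ l * 'C(s + l, l)%:R * 'C(n + 2 * s + l, 3 * s + 2 * l + 2)%:R.
Proof.
elim/nat_ind3: n s l => [|||n IH0 IH1 IH2] s l.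
- by rewrite /= !coef0 (@bin_small _ (3 * _ + 2 * _ + 2)%N) ?mulr0 //; lia.
- by rewrite /= !coef0 (@bin_small _ (3 * _ + 2 * _ + 2)%N) ?mulr0 //; lia.
- rewrite /= coef1; case: s => [|s]; last first.
    by rewrite coef0 (@bin_small _ (3 * _ + 2 * _ + 2)%N) ?mulr0 //; lia.
  rewrite coef1; case: l => [|l].
    by rewrite !bin0 expr0 !mul1r.
  by rewrite (@bin_small _ (3 * _ + 2 * _ + 2)%N) ?mulr0 //; lia.
pose d := hsymS3 (3%:R - X + 'X) (3%:R - X) n; rewrite {}d.
set a := hsym _ _ n.+2 in IH2 *; set b := hsym _ _ n.+1 in IH1 *.
set c := hsym _ _ n in IH0 *.
have -> : (3%:R - X + 'X) * a - (3%:R - X) * b + c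
        = a *+ 3 - X * a + 'X * a - b *+ 3 + X * b + c by ring.
rewrite !(coefD, coefN, coefMn) !coef_XM !coef_YM.
case: s l => [|s] [|l]; rewrite !IH0 !IH1 !IH2 {a b c IH0 IH1 IH2}.
- by rewrite !(muln0, addn0, add0n, bin0) (binS3 n) /=; ring.
- rewrite !(muln0, addn0, add0n, binn).
  have -> : (2 * l.+1 + 2 = (2 * l).+1.+3)%N by lia.
  have -> : (2 * l + 2 = (2 * l).+2)%N by lia.
  rewrite !(addSn, addnS) (binS3 (n + l).+1) /= (binS (n + l).+1 (2 * l).+1).
  by rewrite natrD !exprS; ring.
- rewrite !(muln0, addn0, add0n, bin0).
  have -> : (3 * s.+1 + 2 = (3 * s).+2.+3)%N by lia.
  have -> : (3 * s + 2 = (3 * s).+2)%N by lia.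
  by rewrite (mulnS 2 s) !(addSn, addnS) (binS3 (n + 2 * s).+2) /=; ring.
have -> : (3 * s.+1 + 2 * l.+1 + 2 = (3 * s + 2 * l).+4.+3)%N by lia.
have -> : (3 * s.+1 + 2 * l + 2 = (3 * s + 2 * l).+4.+1)%N by lia.
have -> : (3 * s + 2 * l.+1 + 2 = (3 * s + 2 * l).+4)%N by lia.
rewrite (mulnS 2 s) !(addSn, addnS) (binS3 (n + 2 * s + l).+3) /= (binS _ (3 * s + 2 * l).+4) (binS (s + l).+1 l).
by rewrite !natrD !exprS; ring.
Qed.

End Coefficients.

(** * The harmonic q-series as nested sums *)

(* Weight 0 at m = 0 encodes the constraint m_d > 0. *)
Definition mhqs_weight (F : fieldType) (q : F) (m k : nat) : F :=
  if m is 0%N then 0 else q ^+ (k.-1 * m) / qint q m ^+ k.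

Lemma mhqsE (F : fieldType) (q : F) n ks :
  mhqs n ks q = nested_sum (mhqs_weight q) n ks.
Proof.
rewrite -(tuple_sumE _ _ (leqnn n)) /mhqs big_mkcondr /=.
apply: eq_big => [t|t _].
  by case: (tval t) => //= i r; rewrite ltn_ord.
case: ifP => [/allP t_gt0|/allPn[_ /tnthP[i ->]]].
  apply: eq_bigr => i _; rewrite /mhqs_weight.
  by have := t_gt0 _ (mem_tnth i t); case: (nat_of_ord _).
rewrite -eqn0Ngt => /eqP ti0; rewrite (bigD1 i) //= /mhqs_weight ti0 mul0r //.
Qed.

Lemma W2E (F : fieldType) (q : F) n l s :
  W2 n l s q = word_sum s l (nested_sum (mhqs_weight q) n).
Proof.
rewrite -(@word_sumE _ l.+1) //.
by apply: eq_bigr => d _; rewrite mhqsE.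
Qed.

(** * Products over roots of unity *)

Section RootsOfUnity.
Variables (F : fieldType) (z : F) (n : nat).
Hypothesis z_prim : n.-primitive_root z.

(** The factorization of X^n - 1 is evaluated at [a^-1] and multiplied by [a ^+ n]. *)
Lemma prod_1subM_unity_root a : \prod_(m < n) (1 - a * z ^+ m) = 1 - a ^+ n.
Proof.
have n_gt0 := prim_order_gt0 z_prim.
have [->|a0] := eqVneq a 0.
  by rewrite expr0n gtn_eqF // subr0 big1 // => m _; rewrite mul0r subr0.
have := congr1 (horner^~ a^-1) (factor_Xn_sub_1 z_prim).
rewrite horner_prod big_mkord !hornerE => /(congr1 ( *%R (a ^+ n))).
rewrite mulrBr -exprMn divff // expr1n mulr1 => <-.
rewrite -[X in a ^+ X]card_ord -prodr_const -big_split /=.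
by apply: eq_bigr => m _; rewrite !hornerE mulrBr divff.
Qed.

(** After cancelling X - 1 from X^n - 1, the remaining geometric sum takes the value [n] at 1. *)
Lemma prod_1sub_unity_root : \prod_(1 <= m < n) (1 - z ^+ m) = n%:R.
Proof.
have n_gt0 := prim_order_gt0 z_prim.
have := factor_Xn_sub_1 z_prim.
rewrite big_ltn // expr0 subrX1 => /mulfI.
move=> /(_ (negbT (polyXsubC_eq0 1))) /(congr1 (horner^~ 1)).
rewrite horner_prod horner_sum.
under eq_bigr do rewrite !hornerE.
under [in RHS]eq_bigr do rewrite !hornerE expr1n.
by rewrite sumr_const card_ord.
Qed.

Lemma unity_root_neq1 m : (0 < m < n)%N -> 1 - z ^+ m != 0.
Proof.
move=> /andP[m0 mn]; rewrite subr_eq0 eq_sym -(prim_order_dvd z_prim).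
by rewrite gtnNdvd.
Qed.

End RootsOfUnity.

(** * Splitting the cubic, and polynomial identities from values *)

Lemma cubic_roots (F : closedFieldType) (e1 e2 : F) :
  exists a b c, [/\ a + b + c = e1, a * b + b * c + c * a = e2 & a * b * c = 1].
Proof.
have [a] := @solve_monicpoly F 3 (nth 0 [:: 1; - e2; e1]) isT.
rewrite !big_ord_recl big_ord0 /bump /= => aE.
(* The quotient of t^3 - e1 t^2 + e2 t - 1 by t - a is t^2 - (e1 - a) t + (e2 - e1 a + a^2). *)
have [b] := @solve_monicpoly F 2 (nth 0 [:: - (e2 - e1 * a + a ^+ 2); e1 - a]) isT.
rewrite !big_ord_recl big_ord0 /bump /= => bE.
have bcE : b * (e1 - a - b) = e2 - e1 * a + a ^+ 2.
  by rewrite mulrBr -expr2 bE; ring.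
exists a, b, (e1 - a - b); split; first by ring.
  by rewrite bcE; ring.
by rewrite -mulrA bcE !mulrDr -!exprS aE; ring.
Qed.

Lemma poly_nat_inj (A : idomainType) (p q : {poly A}) :
    injective (fun i : nat => i%:R : A) ->
  (forall i : nat, p.[i%:R] = q.[i%:R]) -> p = q.
Proof.
move=> A0 pq; apply/eqP; rewrite -subr_eq0; apply/negPn/negP => pq0.
have := max_poly_roots (rs := [seq i%:R | i <- iota 0 (size (p - q))]) pq0.
rewrite (map_inj_uniq A0) iota_uniq size_map size_iota ltnn => H.
apply/notF/H => //; apply/allP => _ /mapP[i _ ->].
by rewrite rootE !hornerE pq subrr.
Qed.

(** Reduces an identity in x and y to scalar values, where the cubic can be split; in characteristic
    0 the naturals give enough points for each variable. *)
Lemma poly2_ext (F : numFieldType) (p q : {poly {poly F}}) :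
  (forall x y, p.[y%:P].[x] = q.[y%:P].[x]) -> p = q.
Proof.
have F0 : injective (fun i : nat => i%:R : F).
  by move=> i j /eqP; rewrite Num.Theory.eqr_nat => /eqP.
move=> pq; apply: poly_nat_inj => [i j|i].
  by rewrite -!polyC_natr => /polyC_inj /F0.
by apply: poly_nat_inj F0 _ => j; rewrite -polyC_natr pq.
Qed.

Arguments hsym : simpl never.

(** * The generating function at a root of unity *)

Section GeneratingFunction.
Variables (F : numClosedFieldType) (z : F) (n : nat).
Hypothesis z_prim : n.-primitive_root z.

Definition weight2 (m : nat) : F := if m is 0%N then 0 else z ^+ m / (1 - z ^+ m) ^+ 2.
Definition weight3 (m : nat) : F :=
  if m is 0%N then 0 else z ^+ (2 * m) / (1 - z ^+ m) ^+ 3.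

Local Notation X := ('X : {poly F})%:P.

Lemma horner_word_gf x y :
  y * n%:R ^+ 3 * \prod_(m < n) (1 + weight2 m * x + weight3 m * y) =
  psum (3%:R - x + y) (3%:R - x) n - psum (3%:R - x) (3%:R - x + y) n.
Proof.
have n_gt0 := prim_order_gt0 z_prim.
have [a [b [c [e1 e2 e3]]]] := cubic_roots (3%:R - x) (3%:R - x + y).
(* As abc = 1, the products ab, bc, ca are the inverses of c, a, b, so their elementary symmetric
   functions are those of a, b, c with the first two exchanged. *)
have e1' : a * b * (b * c) + b * c * (c * a) + c * a * (a * b) = 3%:R - x.
  by rewrite -e1 -[RHS]mul1r -e3; ring.
have -> : psum (3%:R - x) (3%:R - x + y) n = a ^+ n + b ^+ n + c ^+ n.
  by rewrite -e2 -e1 psum_roots.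
have -> : psum (3%:R - x + y) (3%:R - x) n = (a * b) ^+ n + (b * c) ^+ n + (c * a) ^+ n.
  by rewrite -e2 -e1' psum_roots // -(expr1n F 2) -e3; ring.
have -> : (a * b) ^+ n + (b * c) ^+ n + (c * a) ^+ n - (a ^+ n + b ^+ n + c ^+ n)
       = (1 - a ^+ n) * (1 - b ^+ n) * (1 - c ^+ n).
  have: (a * b * c) ^+ n = 1 by rewrite e3 expr1n.
  rewrite !exprMn => E; transitivity (1 - a ^+ n - b ^+ n - c ^+ n
    + a ^+ n * b ^+ n + b ^+ n * c ^+ n + c ^+ n * a ^+ n - 1); first by ring.
  by rewrite -{2}E; ring.
rewrite -!(prod_1subM_unity_root z_prim) -!big_split /=.
have PE u : (1 - a * u) * (1 - b * u) * (1 - c * u)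
          = (1 - u) ^+ 3 + x * u * (1 - u) + y * u ^+ 2.
  transitivity (1 - (a + b + c) * u + (a * b + b * c + c * a) * u ^+ 2
     - (a * b * c) * u ^+ 3); first by ring.
  by rewrite e1 e2 e3; ring.
under [RHS]eq_bigr do rewrite PE.
rewrite -(prod_1sub_unity_root z_prim) -prodrXl.
rewrite -(big_mkord xpredT (fun m => 1 + weight2 m * x + weight3 m * y)).
rewrite -(big_mkord xpredT (fun m =>
  (1 - z ^+ m) ^+ 3 + x * z ^+ m * (1 - z ^+ m) + y * (z ^+ m) ^+ 2)).
(* The factor at m = 0 is 1 on the left and P(1) = y on the right; for m > 0 the cubes from
   [n%:R ^+ 3] clear the denominators. *)
rewrite !(big_ltn n_gt0) /= expr0.
rewrite !mul0r !addr0 mul1r subrr expr0n mulr0 add0r expr1n mulr1 add0r.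
rewrite -mulrA -big_split /= !big_nat; congr (_ * _).
apply: eq_bigr => m mn; have := unity_root_neq1 z_prim mn.
case: m mn => // m _ d0; rewrite /weight2 /weight3 mulnC exprM.
by field.
Qed.

Lemma word_gf_psum :
  'X * (n%:R ^+ 3 * word_gf weight2 weight3 n) =
  psum (3%:R - X + 'X) (3%:R - X) n - psum (3%:R - X) (3%:R - X + 'X) n.
Proof.
apply: poly2_ext => x y.
pose f : {rmorphism {poly {poly F}} -> F} := horner_eval x \o horner_eval y%:P.
have fE p : p.[y%:P].[x] = f p by [].
have fX : f X = x by rewrite -fE !hornerE.
have fY : f 'X = y by rewrite -fE !hornerE.
rewrite !fE rmorphB !rmorph_psum rmorphD rmorphB fX fY rmorph_nat.
rewrite -horner_word_gf rmorphM fY rmorphM rmorphXn rmorph_nat mulrA; congr (_ * _).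
rewrite /word_gf rmorph_prod; apply: eq_bigr => m _.
by rewrite -fE !hornerE.
Qed.

(** Differentiating [word_gf_psum] in y turns the factor ['X] into [s.+1] on coefficients. On the
    right y sits in [e1] of one power sum and in [e2] of the other, so the degrees are [n.+1] and
    [n] and both terms enter with a plus sign; one factor [n] cancels. *)
Lemma coef_word_gf_unity s l :
  n%:R ^+ 2 * s.+1%:R * (word_gf weight2 weight3 n)`_s`_l =
  (-1) ^+ l * 'C(s + l, l)%:R
  * ('C(n + 2 * s + l + 1, 3 * s + 2 * l + 2)%:R
     + (-1) ^+ s * 'C(n + s + l, 3 * s + 2 * l + 2)%:R).
Proof.
have n0 : n%:R != 0 :> F.
  by rewrite Num.Theory.pnatr_eq0 -lt0n (prim_order_gt0 z_prim).
have dX : (3%:R - X)^`() = 0 by rewrite derivB -polyC_natr !derivC subrr.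
have dXY : (3%:R - X + 'X)^`() = 1 by rewrite derivD dX derivX add0r.
have := congr1 (fun p : {poly {poly F}} => (p^`())`_s`_l) word_gf_psum.
rewrite derivB deriv_psum (deriv_psum (3%:R - X)) dX dXY.
rewrite mul1r mul0r subr0 mul0r sub0r mul1r mulrN opprK -mulrDr.
rewrite coef_natM coef_deriv coefMn coefXM /= -natrX coef_natM.
rewrite !coefD coef_hsym1 coef_hsym2 => E.
apply: (mulfI n0); move: E; rewrite exprD addn1 !addSn natrX => E.
transitivity (n%:R ^+ 3 * (word_gf weight2 weight3 n)`_s`_l *+ s.+1).
  by rewrite -mulr_natr; ring.
by rewrite E; ring.
Qed.

End GeneratingFunction.

Theorem theorem1p2 (R : realType) (n : nat) (n_gt0 : (0 < n)%N) (zeta : R[i])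
    (zeta_prim : n.-primitive_root zeta) (l s : nat) :
  W2 n l s zeta =
  (-1) ^+ l / ((n ^ 2)%:R * s.+1%:R) * 'C(s + l, l)%:R
  * ('C(n + 2 * s + l + 1, 3 * s + 2 * l + 2)%:R
     + (-1) ^+ s * 'C(n + s + l, 3 * s + 2 * l + 2)%:R)
  * (1 - zeta) ^+ (3 * s + 2 * l).
Proof.
(* Each letter k contributes (1 - zeta)^k from 1 / [m]^k. With 0^-1 = 0 this holds for every m, even
   where a denominator vanishes. *)
have wE k m : mhqs_weight zeta m k.+1 = (1 - zeta) ^+ k.+1 *
    (if m is 0%N then 0 else zeta ^+ (k * m) / (1 - zeta ^+ m) ^+ k.+1).
  case: m => [|m]; first by rewrite mulr0.
  by rewrite /mhqs_weight /qint expr_div_n invf_div mulrCA.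
rewrite W2E (coef_word_gf (a := weight2 zeta) (b := weight3 zeta) (c := 1 - zeta)).
- have n0 : n%:R != 0 :> R[i] by rewrite Num.Theory.pnatr_eq0 -lt0n.
  have s0 : s.+1%:R != 0 :> R[i] by rewrite Num.Theory.pnatr_eq0.
  rewrite mulrC; congr (_ * _).
  apply: (mulfI (mulf_neq0 (expf_neq0 2 n0) s0)).
  rewrite (coef_word_gf_unity zeta_prim) natrX.
  by move: (s.+1%:R) (n%:R) s0 n0 => t u t0 u0; field; rewrite t0 u0.
- by move=> m; rewrite wE; case: m => //= m; rewrite mul1n.
- by move=> m; rewrite wE; case: m.
Qed.
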